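(* Let $1\leq\rho\leq2$ and let $r\ge 1$ be a real number. Then $$\psi_\rho(r)\leq X_\rho(r)+\sqrt{X_\rho(r)^2-1},$$ where $$X_\rho(r)=\frac{2+\rho r^2-\rho+\sqrt{(2+\rho r^2-\rho)^2-4r^2}}{2r}.$$
   Context: For a complex Hilbert space $H$, $\mathcal{B}(H)$ denotes the algebra of bounded linear operators on $H$, with operator norm $\|\cdot\|$. For real $\rho\ge 1$, the class $\mathcal{C}_\rho$ consists of the operators $T\in\mathcal{B}(H)$ admitting a unitary $\rho$-dilation: there exist a Hilbert space $\mathcal{H}\supset H$ (containing $H$ as a closed subspace) and a unitary operator $U\in\mathcal{B}(\mathcal{H})$ such that $T^n=\rho\, P U^n P^*$ for all $n=1,2,\dots$, where $P:\mathcal{H}\to H$ is the orthogonal projection from $\mathcal{H}$ onto $H$ (so $P^*:H\to\mathcal{H}$ is the inclusion). The operator $\rho$-radius is $$w_\rho(A)=\inf\{\lambda>0 : \lambda^{-1}A\in\mathcal{C}_\rho\}.$$ For real $r\ge1$, define $$\psi_\rho(r)=\sup\{\|A\| : A\in\mathcal{B}(H),\ A\text{ invertible},\ w_\rho(A)\leq r,\ w_\rho(A^{-1})\leq r\},$$ where the supremum is also taken over all complex Hilbert spaces $H$. *)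

(* Defs.v *)
From HB Require Import structures.
From mathcomp Require Import all_boot all_order all_algebra.
From mathcomp Require Import sesquilinear complex.
From mathcomp Require Import boolp classical_sets reals ereal topology normedtype.

Set Implicit Arguments.
Unset Strict Implicit.
Unset Printing Implicit Defensive.

Import Order.TTheory GRing.Theory Num.Theory.
Import numFieldNormedType.Exports.

Local Open Scope classical_set_scope.
Local Open Scope complex_scope.
Local Open Scope ring_scope.

(* The norm of a normed module over R[i] takes its values in R[i]; the inner
   product is linear in its first argument and semilinear in the second. *)
HB.mixin Record CompleteNormedModule_isHilbert (R : realType) H
    of CompleteNormedModule R[i] H := {
  inner : {dot H for Num.conj};
  inner_normE : forall x : H, inner x x = `|x| ^+ 2
}.

#[short(type="hilbertType")]
HB.structure Definition Hilbert (R : realType) :=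
  {H of CompleteNormedModule R[i] H & CompleteNormedModule_isHilbert R H}.

Definition bounded_op (R : realType) (H K : hilbertType R)
    (A : {linear H -> K}) : Prop :=
  bounded_near A (nbhs (0 : H)).

Definition opnorm (R : realType) (H K : hilbertType R)
    (A : {linear H -> K}) : \bar R :=
  ereal_sup [set (complex.Re `|A x|)%:E | x in [set x : H | `|x| <= 1]].

Definition adjoint (R : realType) (H K : hilbertType R)
    (A : {linear H -> K}) (B : {linear K -> H}) : Prop :=
  forall x y, inner (A x) y = inner x (B y).

Definition inverse_op (R : realType) (H K : hilbertType R)
    (A : {linear H -> K}) (B : {linear K -> H}) : Prop :=
  [/\ bounded_op B, cancel A B & cancel B A].

Definition unitary_op (R : realType) (H : hilbertType R)
    (U : {linear H -> H}) : Prop :=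
  bounded_op U /\
  exists V : {linear H -> H}, adjoint U V /\ inverse_op U V.

(* [J] embeds H isometrically in K, so that its range is a closed subspace, and
   [P] is the orthogonal projection of K onto that copy of H; then P^* = J. *)
Definition subspace_projection (R : realType) (H K : hilbertType R)
    (J : {linear H -> K}) (P : {linear K -> H}) : Prop :=
  isometry inner inner J /\ forall k h, inner (k - J (P k)) (J h) = 0.

Definition rho_class (R : realType) (rho : R) (H : hilbertType R)
    (T : {linear H -> H}) : Prop :=
  bounded_op T /\
  exists (K : hilbertType R) (J : {linear H -> K}) (P : {linear K -> H})
         (U : {linear K -> K}),
    [/\ subspace_projection J P, unitary_op U &
        forall n, (0 < n)%N -> forall x,
          iter n T x = rho%:C *: P (iter n U (J x))].

(* In the extended reals: an empty set of admissible l would give +oo, so that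
   no bound on rho_radius can hold vacuously. *)
Definition rho_radius (R : realType) (rho : R) (H : hilbertType R)
    (A : {linear H -> H}) : \bar R :=
  ereal_inf [set l%:E | l in
    [set l : R | 0 < l /\ rho_class rho (l^-1%:C \*: A)]].

Definition psi (R : realType) (rho r : R) : \bar R :=
  ereal_sup [set t | exists (H : hilbertType R) (A B : {linear H -> H}),
    [/\ bounded_op A, inverse_op A B,
        (rho_radius rho A <= r%:E)%E, (rho_radius rho B <= r%:E)%E
      & t = opnorm A]].

Definition Xrho (R : realType) (rho r : R) : R :=
  (2 + rho * r ^+ 2 - rho
   + Num.sqrt ((2 + rho * r ^+ 2 - rho) ^+ 2 - 4 * r ^+ 2)) / (2 * r).

(* Main.v *)
(* Write S' for the adjoint of S. If T has a unitary rho-dilation, dilating the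
   difference sequence v_i - T v_(i-1) of a finite sequence v gives
     (2 - rho) sum |T v_i|^2 + 2 (rho - 1) sum Re <T v_i, v_(i+1)>
       <= rho sum |v_i|^2.
   Let B be the inverse of A. Rescaled by r, the inequality holds for A and for
   B', hence by convexity of the square for M = (A + B') / 2. Both M and M' are
   bounded below by 1, because <A x, B' x> = |x|^2. Testing the inequality on a
   sequence that passes through x and M x, prolonged to the left by M' and to
   the right by M with geometrically decaying norms, yields |M x| <= X |x|.
   Finally 4 |M x|^2 = |A x|^2 + 2 |x|^2 + |B' x|^2 and |x|^2 <= |A x| |B' x|
   turn this into s + 1/s <= 2 X for s = |A x| / |x|. *)

Require Import Defs.
From mathcomp Require Import all_boot all_order all_algebra.
From mathcomp Require Import sesquilinear complex ring lra.
From mathcomp Require Import boolp classical_sets reals ereal.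
From mathcomp Require Import topology normedtype sequences.

Set Implicit Arguments.
Unset Strict Implicit.
Unset Printing Implicit Defensive.

Import Order.TTheory GRing.Theory Num.Theory.
Import numFieldNormedType.Exports.

Local Open Scope complex_scope.
Local Open Scope ring_scope.

(** * Real inner product and the energy of a finite path *)

Section RealInner.
Context {R : realType} {H : hilbertType R}.
Implicit Types x y z : H.

(** Taking real parts moves all estimates into the ordered field [R]. *)
Definition rdot x y : R := complex.Re (inner x y).
Definition nsq x : R := rdot x x.

Lemma rdotDl x y z : rdot (x + y) z = rdot x z + rdot y z.
Proof.
have -> : rdot (x + y) z = complex.Re (inner x z + inner y z).
  by congr complex.Re; exact: (linearDl (@inner R H) z x y).
by rewrite /rdot; case: (inner x z) (inner y z) => ? ? [].
Qed.

Lemma rdotC x y : rdot x y = rdot y x.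
Proof.
have -> : rdot x y = complex.Re (Num.conj (inner y x)).
  congr complex.Re; rewrite -[RHS]mul1r -(expr0 (-1)).
  exact: (@hermC _ false Num.conj _ (@inner R H) x y).
by rewrite /rdot; case: (inner y x).
Qed.

Lemma rdotDr x y z : rdot z (x + y) = rdot z x + rdot z y.
Proof. by rewrite !(rdotC z) rdotDl. Qed.

Lemma rdotZl a x y : rdot (a%:C *: x) y = a * rdot x y.
Proof.
have -> : rdot (a%:C *: x) y = complex.Re (a%:C * inner x y).
  by congr complex.Re; exact: (linearZl_LR (@inner R H) y a%:C x).
by rewrite /rdot; case: (inner x y) => u v /=; rewrite mul0r subr0.
Qed.

Lemma rdotZr a x y : rdot x (a%:C *: y) = a * rdot x y.
Proof. by rewrite !(rdotC x) rdotZl. Qed.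

Lemma rdotNl x y : rdot (- x) y = - rdot x y.
Proof.
by rewrite -[- x]scaleN1r -(rmorphN1 (real_complex R)) rdotZl mulN1r.
Qed.

Lemma rdotNr x y : rdot x (- y) = - rdot x y.
Proof. by rewrite !(rdotC x) rdotNl. Qed.

Lemma nsq_normE x : nsq x = (complex.Re `|x|) ^+ 2.
Proof.
rewrite /nsq /rdot inner_normE.
have := normr_ge0 x; rewrite lecE => /andP[/eqP /= h _].
case: `|x| h => u v /= ->; rewrite !expr2 /=; ring.
Qed.

Lemma nsq_ge0 x : 0 <= nsq x.
Proof. by rewrite nsq_normE sqr_ge0. Qed.

Lemma nsq_eq0 x : nsq x = 0 -> x = 0.
Proof.
rewrite nsq_normE => /eqP; rewrite sqrf_eq0 => /eqP h0.
have := normr_ge0 x; rewrite lecE => /andP[/eqP /= h _].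
by apply: normr0_eq0; case: `|x| h h0 => u v /= -> ->.
Qed.

Lemma nsqD x y : nsq (x + y) = nsq x + 2 * rdot x y + nsq y.
Proof. rewrite /nsq !rdotDl !rdotDr (rdotC y x); ring. Qed.

Lemma nsqN x : nsq (- x) = nsq x.
Proof. by rewrite /nsq rdotNl rdotNr opprK. Qed.

Lemma nsqZ a x : nsq (a%:C *: x) = a ^+ 2 * nsq x.
Proof. by rewrite /nsq rdotZl rdotZr mulrA expr2. Qed.

Lemma nsqB x y : nsq (x - y) = nsq x - 2 * rdot x y + nsq y.
Proof. rewrite nsqD nsqN rdotNr; ring. Qed.

Lemma sqr_rdot_le x y : rdot x y ^+ 2 <= nsq x * nsq y.
Proof.
have [y0|ypos] := eqVneq (nsq y) 0.
  by rewrite (nsq_eq0 y0) /nsq -(scale0r (0 : H)) (rdotZr 0) !(rdotZr 0); nra.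
have yp : 0 < nsq y by rewrite lt_def ypos nsq_ge0.
have := nsq_ge0 ((nsq y)%:C *: x - (rdot x y)%:C *: y).
rewrite nsqB !nsqZ rdotZl rdotZr => h.
rewrite -subr_ge0 -(pmulr_rge0 _ yp); apply: le_trans h _.
by rewrite le_eqVlt; apply/orP; left; apply/eqP; ring.
Qed.

(* Summed over a path v_0, ..., v_N with v_(N+1) = 0:
   e sum |v_i|^2 - k sum |T v_i|^2 - 2 d sum Re <T v_i, v_(i+1)>. *)
Fixpoint energy (T : H -> H) (e d k : R) (v : H) (s : seq H) : R :=
  if s is w :: s' then
    e * nsq v - k * nsq (T v) - 2 * d * rdot (T v) w + energy T e d k w s'
  else e * nsq v - k * nsq (T v).

Lemma energy_linear T e d k v s :
  energy T e d k v s =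
  e * energy T 1 0 0 v s + d * energy T 0 1 0 v s + k * energy T 0 0 1 v s.
Proof. by elim: s v => [|w s IHs] v /=; rewrite ?IHs; ring. Qed.

Lemma energy001_le0 T v s : energy T 0 0 1 v s <= 0.
Proof.
elim: s v => [|w s IHs] v /=; have := nsq_ge0 (T v); last have := IHs w.
all: nra.
Qed.

Lemma energyZ T a e d k v s :
  energy (fun x => a%:C *: T x) e d k v s = energy T e (a * d) (a ^+ 2 * k) v s.
Proof.
by elim: s v => [|w s IHs] v /=; rewrite ?IHs nsqZ ?rdotZl; ring.
Qed.

Lemma energy100_ge0 T v s : 0 <= energy T 1 0 0 v s.
Proof.
elim: s v => [|w s IHs] v /=; have := nsq_ge0 v; last have := IHs w.
all: nra.
Qed.

(* As a function of [l] this is a convex quadratic that is nonpositive at 0,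
   so it stays nonnegative once it is so at a positive point. *)
Lemma energy_monotone T e d k l m v s :
  0 <= e -> 0 <= k -> 0 < l -> l <= m ->
  0 <= energy T (e * l ^+ 2) (d * l) k v s ->
  0 <= energy T (e * m ^+ 2) (d * m) k v s.
Proof.
rewrite ![energy _ _ _ k _ _]energy_linear => e0 k0 l0 lm.
have := energy001_le0 T v s; have := energy100_ge0 T v s.
move: (energy T 1 0 0 v s) (energy T 0 1 0 v s) (energy T 0 0 1 v s) => a b c.
move=> a0 c0 h.
have m0 : 0 < m by apply: lt_le_trans lm.
rewrite -(pmulr_rge0 _ l0).
have -> : l * (e * m ^+ 2 * a + d * m * b + k * c) =
  m * (e * l ^+ 2 * a + d * l * b + k * c)
  + (m - l) * (e * a * (m * l) - k * c) by ring.
have ea : 0 <= e * a by apply: mulr_ge0.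
have ml : 0 <= m * l by rewrite mulr_ge0 // ltW.
have kc : k * c <= 0 by apply: mulr_ge0_le0.
apply: addr_ge0; first by rewrite mulr_ge0 // ltW.
by apply: mulr_ge0; [rewrite subr_ge0 | nra].
Qed.

End RealInner.

(** * Scalar facts on geometric decay *)

Lemma geometric_limit_ge0 (R : realType) (a b t : R) :
  0 <= t < 1 -> (forall n, 0 <= a + b * t ^+ n) -> 0 <= a.
Proof.
move=> /andP[t0 t1] h.
have cv : ((fun n => a + b * t ^+ n) @ \oo --> a + b * 0)%classic.
  apply: cvgD; first exact: cvg_cst.
  apply: cvgM; first exact: cvg_cst.
  by apply: cvg_expr; rewrite ger0_norm.
rewrite mulr0 addr0 in cv.
rewrite -(cvg_lim (@Rhausdorff R) cv).
apply: limr_ge; first by apply/cvg_ex; exists a.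
by near=> n; exact: h.
Unshelve. all: by end_near.
Qed.

(** With [a = nsq u] and [b = nsq (M u)], [l] rescales [M u] to norm [c] times that of [u]; as
    [a <= b], the cross term [l * b] is then at least [c * a]. *)
Lemma exists_scale (R : realType) (a b c : R) :
  0 <= a -> 0 <= b -> 0 <= c -> a <= b ->
  exists l, 0 <= l /\ l ^+ 2 * b = c ^+ 2 * a /\ c * a <= l * b.
Proof.
move=> a0 b0 c0 ab; exists (c * Num.sqrt (a / b)).
have l0 : 0 <= c * Num.sqrt (a / b) by rewrite mulr_ge0 ?sqrtr_ge0.
have lE : (c * Num.sqrt (a / b)) ^+ 2 * b = c ^+ 2 * a.
  rewrite exprMn sqr_sqrtr ?divr_ge0 // -mulrA.
  have [bE|bn0] := eqVneq b 0; last by rewrite divfK.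
  have aE : a = 0 by lra.
  by rewrite aE !mul0r.
split=> //; split=> //.
rewrite -ler_sqr ?nnegrE ?mulr_ge0 //.
have -> : (c * a) ^+ 2 = c ^+ 2 * a * a by ring.
have -> : (c * Num.sqrt (a / b) * b) ^+ 2 = c ^+ 2 * a * b.
  by rewrite -lE; ring.
by rewrite ler_wpM2l ?mulr_ge0 ?sqr_ge0.
Qed.

(** * Energy bounds along geometrically decaying paths *)

Section ExtremalPath.
Context {R : realType} {H : hilbertType R}.
Variables (M M' : H -> H) (e d k g : R).
Hypothesis MM' : forall x y, rdot (M x) y = rdot x (M' y).
Hypothesis nsqM : forall x, nsq x <= nsq (M x).
Hypothesis nsqM' : forall x, nsq x <= nsq (M' x).
Hypotheses (d_ge0 : 0 <= d) (k_ge0 : 0 <= k) (d_lt_g : d < g).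
Hypothesis gE : g ^+ 2 - (e - k) * g + d ^+ 2 = 0.
Hypothesis energy_ge0 : forall v s, 0 <= energy M e d k v s.

(* [t] is the decay rate of the ground state of the two-sided Jacobi form with
   diagonal [e - k] and off-diagonal [- d], perturbed at one edge. *)
Let t := d / g.
Let g_gt0 : 0 < g. Proof. exact: le_lt_trans d_lt_g. Qed.
Let t01 : 0 <= t < 1.
Proof. by rewrite /t divr_ge0 ?ltr_pdivrMr ?mul1r // ltW. Qed.
Let tt01 : 0 <= t ^+ 2 < 1.
Proof. by move: t01 => /andP[t0 t1]; rewrite sqr_ge0 expr_lt1. Qed.
Let dE : d = g * t. Proof. by rewrite /t mulrC divfK // gt_eqF. Qed.
Let ekE : e - k = g + d * t.
Proof.
apply: (mulIf (lt0r_neq0 g_gt0)); rewrite dE.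
by have := gE; rewrite [in X in X -> _]dE; lra.
Qed.

(* Prolong the path to the left by multiples of [M' u], [M' (M' u)], ..., with
   norms decaying like [t ^+ n]. *)
Lemma backward_path n u s :
  0 <= energy M e d k u s - d * t * nsq u + d * t * nsq u * (t ^+ 2) ^+ n.
Proof.
elim: n u s => [|n IHn] u s.
  by rewrite expr0 mulr1 subrK.
case/andP: (t01) => t0 _.
have [l [l0 [l1 l2]]] := exists_scale (nsq_ge0 u) (nsq_ge0 (M' u)) t0 (nsqM' u).
have := IHn (l%:C *: M' u) (u :: s).
rewrite /= MM' rdotZl nsqZ l1 -/(nsq (M' u)) => h.
have kM : 0 <= k * nsq (M (l%:C *: M' u) ) - k * (t ^+ 2 * nsq u).
  by rewrite -l1 -nsqZ -mulrBr mulr_ge0 // subr_ge0.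
have dl : 0 <= d * (l * nsq (M' u) - t * nsq u) by rewrite mulr_ge0 // subr_ge0.
have ek : e = g + d * t + k by rewrite -ekE; ring.
rewrite ek in h |- *; rewrite exprS.
apply: le_trans h _; rewrite -subr_ge0.
set E := energy _ _ _ _ _ _.
(* The choice [t = d / g] makes the last bracket below vanish. *)
have gd : g * (t ^+ 2 * nsq u) = d * t * nsq u by rewrite dE; ring.
set X := nsq (M _) in kM *; set Y := nsq (M' u) in dl *.
set Z := nsq u in gd kM dl *; set W := (t ^+ 2) ^+ n.
have -> : E - d * t * Z + d * t * Z * (t ^+ 2 * W) -
  ((g + d * t + k) * (t ^+ 2 * Z) - k * X - 2 * d * (l * Y) + E -
   d * t * (t ^+ 2 * Z) + d * t * (t ^+ 2 * Z) * W)
  = (k * X - k * (t ^+ 2 * Z)) + 2 * (d * (l * Y - t * Z)) +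
   (d * t * Z - g * (t ^+ 2 * Z)) by ring.
by rewrite gd subrr addr0; lra.
Qed.

(** In the limit of an infinite left tail, that tail contributes at most [- d * t * nsq u], while
    the total stays nonnegative. *)
Lemma energy_ge u s : d * t * nsq u <= energy M e d k u s.
Proof.
rewrite -subr_ge0; apply: (geometric_limit_ge0 tt01) => n.
exact: backward_path.
Qed.

(** Continuing by multiples of [M y], [M (M y)], ... with decay rate [t] costs no more than in the
    scalar case [M = 1], where the infinite path has energy exactly [g * nsq y]. *)
Lemma forward_path n y :
  exists s, energy M e d k y s <= (g + d * t * (t ^+ 2) ^+ n) * nsq y.
Proof.
have ek : e = g + d * t + k by rewrite -ekE; ring.
elim: n y => [|n IHn] y.
  exists [::]; rewrite /= expr0 mulr1 ek.
  have : 0 <= k * (nsq (M y) - nsq y) by rewrite mulr_ge0 // subr_ge0.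
  by lra.
case/andP: (t01) => t0 _.
have [l [l0 [l1 l2]]] := exists_scale (nsq_ge0 y) (nsq_ge0 (M y)) t0 (nsqM y).
have [s hs] := IHn (l%:C *: M y).
exists (l%:C *: M y :: s).
rewrite /= rdotZr -/(nsq _).
have dl : 0 <= d * (l * nsq (M y) - t * nsq y) by rewrite mulr_ge0 // subr_ge0.
have kM : 0 <= k * (nsq (M y) - nsq y) by rewrite mulr_ge0 // subr_ge0.
rewrite nsqZ l1 in hs.
have gd : g * (t ^+ 2 * nsq y) = d * t * nsq y by rewrite dE; ring.
rewrite exprS -subr_ge0.
move: hs; rewrite -subr_ge0 => hs.
set E := energy _ _ _ _ _ _ in hs *; set X := nsq (M y) in kM dl *.
set Z := nsq y in gd kM dl hs *; set W := (t ^+ 2) ^+ n in hs *.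
have -> : (g + d * t * (t ^+ 2 * W)) * Z -
   (e * Z - k * X - 2 * d * (l * X) + E) =
   ((g + d * t * W) * (t ^+ 2 * Z) - E) + 2 * (d * (l * X - t * Z))
   + k * (X - Z) + (d * t * Z - g * (t ^+ 2 * Z)) by rewrite ek; ring.
rewrite gd subrr; lra.
Qed.

(** The test path is [x], [t M x], then a forward path. Its energy is at least [d * t * nsq x], and
    the part from [t M x] on tends to at most [g * t ^+ 2 * nsq (M x) = d * t * nsq (M x)]. *)
Lemma nsq_image_le x : (k * g + d ^+ 2) * nsq (M x) <= g * (g + k) * nsq x.
Proof.
have ek : e = g + d * t + k by rewrite -ekE; ring.
suff h : 0 <= (g + k) * nsq x - (k + d * t) * nsq (M x).
  have : 0 <= g * ((g + k) * nsq x - (k + d * t) * nsq (M x)).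
    by rewrite mulr_ge0 // ltW.
  have -> : d ^+ 2 = g * (d * t) by rewrite [in RHS]mulrCA -dE expr2.
  by lra.
apply: (@geometric_limit_ge0 _ _ (d * t * t ^+ 2 * nsq (M x)) _ tt01) => n.
have [s hs] := forward_path n (t%:C *: M x).
have := energy_ge x (t%:C *: M x :: s).
rewrite nsqZ in hs.
rewrite /= rdotZr -/(nsq _) => h.
have gt : g * t ^+ 2 = d * t by rewrite dE; ring.
have hs' : energy M e d k (t%:C *: M x) s <=
  d * t * nsq (M x) + d * t * t ^+ 2 * nsq (M x) * (t ^+ 2) ^+ n.
  apply: le_trans hs _; rewrite -gt le_eqVlt; apply/orP; left; apply/eqP.
  by ring.
by rewrite ek in h hs'; lra.
Qed.
End ExtremalPath.

(** * The energy inequality for operators with a unitary dilation *)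

Section Dilation.
Context {R : realType} {H K : hilbertType R}.
Variables (rho : R) (T : {linear H -> H}).
Variables (J : {linear H -> K}) (P : {linear K -> H}).
Hypothesis JP : subspace_projection J P.

Lemma rdot_proj z y : rdot z (J y) = rdot (P z) y.
Proof.
case: JP => Jiso Pproj; apply/eqP; rewrite -subr_eq0 -rdotNl; apply/eqP.
have -> : rdot (- P z) y = rdot (- J (P z)) (J y).
  by rewrite !rdotNl; congr (- complex.Re _); rewrite Jiso.
by rewrite -rdotDl /rdot Pproj.
Qed.

Lemma nsq_embedding x : nsq (J x) = nsq x.
Proof. by case: JP => Jiso _; rewrite /nsq /rdot Jiso. Qed.

Section UnitaryPath.
Variable U : {linear K -> K}.
Hypothesis Uiso : forall x, nsq (U x) = nsq x.
Hypothesis TU : forall n, (0 < n)%N ->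
  forall x, iter n T x = rho%:C *: P (iter n U (J x)).

(* [z] dilates the current vertex [v]. Passing to [v'] replaces it by
   [U z + J (v' - T v)], which dilates [v'], and the energy of the edge is
   exactly the increment of [rho (|z|^2 - |v|^2)]. *)
Lemma dilation_energy_from v s z :
  (forall n, rho%:C *: P (iter n.+1 U z) = iter n.+1 T v) ->
  0 <= rho ->
  0 <= rho * (nsq z - nsq v) + energy T rho (rho - 1) (2 - rho) v s.
Proof.
move=> + rho0; elim: s v z => [|w s IHs] v z hz.
  (* The path closes as if the next vertex were 0, leaving exactly [rho * nsq (U z - J (T v))]. *)
  have := mulr_ge0 rho0 (nsq_ge0 (U z - J (T v))).
  rewrite nsqB Uiso nsq_embedding rdot_proj => h.
  have h1 : rho * rdot (P (U z)) (T v) = nsq (T v).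
    by rewrite -rdotZl (hz 0%N).
  move: h; rewrite /=; lra.
(* After projection, [U z] yields [T^(n+2) v] and [J (w - T v)] yields [T^(n+1) w - T^(n+2) v], so
   the terms in [v] cancel. *)
have hz' n : rho%:C *: P (iter n.+1 U (U z + J (w - T v))) = iter n.+1 T w.
  have iterD (L : lmodType R[i]) (f : {linear L -> L}) m a b :
      iter m f (a + b) = iter m f a + iter m f b.
    by elim: m => //= m ->; rewrite linearD.
  rewrite iterD -iterSr linearD scalerDr hz -TU // [X in X + _]iterSr -iterD.
  by rewrite addrC subrK.
have := IHs _ _ hz'; rewrite /= nsqD Uiso nsq_embedding rdot_proj nsqB.
have h1 y : rho * rdot (P (U z)) y = rdot (T v) y by rewrite -rdotZl (hz 0%N).
have h2 := h1 (w - T v); rewrite rdotDr rdotNr -/(nsq (T v)) in h2.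
rewrite (rdotC w) => h; apply: le_trans h _; rewrite le_eqVlt; apply/orP; left.
apply/eqP; move: h2; set E := energy _ _ _ _ _ _.
rewrite rdotDr rdotNr => h2; lra.
Qed.

Lemma dilation_energy v s : 0 <= rho ->
  0 <= energy T rho (rho - 1) (2 - rho) v s.
Proof.
move=> rho0; have := @dilation_energy_from v s (J v).
by rewrite nsq_embedding subrr mulr0 add0r; apply=> // n; rewrite TU.
Qed.
End UnitaryPath.
End Dilation.

Lemma adjoint_rdot (R : realType) (H K : hilbertType R)
    (A : {linear H -> K}) (B : {linear K -> H}) :
  adjoint A B -> forall x y, rdot (A x) y = rdot x (B y).
Proof. by move=> AB x y; rewrite /rdot AB. Qed.

Lemma unitary_nsq (R : realType) (K : hilbertType R) (U : {linear K -> K}) :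
  unitary_op U -> forall x, nsq (U x) = nsq x.
Proof.
by case=> _ [V [UV [_ UK _]]] x; rewrite /nsq (adjoint_rdot UV) UK.
Qed.

(* The adjoint comes from the dilation, [T^* = rho P U^* P^*], so the Riesz
   representation theorem is not needed. *)
Lemma rho_class_energy (R : realType) (rho : R) (H : hilbertType R)
    (T : {linear H -> H}) : 0 <= rho -> rho_class rho T ->
  exists D : {linear H -> H},
    [/\ forall x y, rdot (T x) y = rdot x (D y),
        forall v s, 0 <= energy T rho (rho - 1) (2 - rho) v s &
        forall v s, 0 <= energy D rho (rho - 1) (2 - rho) v s].
Proof.
move=> rho0 [_ [K [J [P [U [JP uU TU]]]]]].
have Uiso := unitary_nsq uU.
case: uU => _ [V [UV [_ UK VK]]].
have Viso x : nsq (V x) = nsq x by rewrite -Uiso VK.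
pose D : {linear H -> H} := rho%:C \*: (P \o (V \o J)).
have DE x : D x = rho%:C *: P (V (J x)) by [].
have JPr := rdot_proj JP.
have iterUV n x y : rdot (iter n U x) y = rdot x (iter n V y).
  by elim: n y => // n IHn y; rewrite iterS (adjoint_rdot UV) IHn -iterSr.
have TnV n x y : (0 < n)%N ->
   rdot (iter n T x) y = rdot x (rho%:C *: P (iter n V (J y))).
  move=> n0; rewrite TU // rdotZl -JPr iterUV rdotZr [in RHS]rdotC -JPr.
  by rewrite rdotC.
have TD x y : rdot (T x) y = rdot x (D y) by rewrite DE (TnV 1%N x y).
have TDn n x y : rdot (iter n T x) y = rdot x (iter n D y).
  by elim: n y => // n IHn y; rewrite iterS TD IHn -iterSr.
exists D; split=> // v s; first exact: (dilation_energy JP Uiso TU).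
apply: (dilation_energy JP Viso) => // n n0 x.
(* [D^n] and [rho P V^n J] are both adjoint to [T^n], so their difference at [x] is orthogonal to
   itself. *)
apply/eqP; rewrite -subr_eq0; apply/eqP/nsq_eq0.
by rewrite /nsq rdotDr rdotNr -TDn -TnV // subrr.
Qed.

(** * From the radius to energies; averaging two operators *)

Lemma energyMl (R : realType) (H : hilbertType R) (T : H -> H) l e d k v s :
  l * energy T e d k v s = energy T (l * e) (l * d) (l * k) v s.
Proof. by rewrite energy_linear [RHS]energy_linear; ring. Qed.

Lemma energy_unscale (R : realType) (H : hilbertType R) (T : H -> H)
    (rho l m : R) v s :
  1 <= rho <= 2 -> 0 < l -> l <= m ->
  0 <= energy (fun x => l^-1%:C *: T x) rho (rho - 1) (2 - rho) v s ->
  0 <= energy T (rho * m ^+ 2) ((rho - 1) * m) (2 - rho) v s.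
Proof.
move=> /andP[rho1 rho2] l0 lm; rewrite energyZ => h.
apply: (@energy_monotone _ _ T rho (rho - 1) (2 - rho) l m) => //; try lra.
have := mulr_ge0 (sqr_ge0 l) h; rewrite energyMl.
have ln0 : l != 0 by rewrite gt_eqF.
have -> : l ^+ 2 * rho = rho * l ^+ 2 by ring.
have -> : l ^+ 2 * (l^-1 * (rho - 1)) = (rho - 1) * l by field.
by have -> : l ^+ 2 * (l^-1 ^+ 2 * (2 - rho)) = 2 - rho by field.
Qed.

(** The infimum may not be attained and the admissible [l] depends on [A]; monotonicity in the scale
    replaces it by any [m] above [r], common to all operators. *)
Lemma rho_radius_energy (R : realType) (rho r m : R) (H : hilbertType R)
    (A : {linear H -> H}) :
  1 <= rho <= 2 -> (rho_radius rho A <= r%:E)%E -> r < m ->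
  exists D : {linear H -> H},
    [/\ forall x y, rdot (A x) y = rdot x (D y),
        forall v s, 0 <= energy A (rho * m ^+ 2) ((rho - 1) * m) (2 - rho) v s &
        forall v s, 0 <= energy D (rho * m ^+ 2) ((rho - 1) * m) (2 - rho) v s].
Proof.
move=> rho12 rA rm; have /andP[rho1 _] := rho12.
have : (rho_radius rho A < m%:E)%E by apply: le_lt_trans rA _; rewrite lte_fin.
move=> /ereal_inf_lt[_ [l [l0 lA] <-]]; rewrite lte_fin => /ltW lm.
have [|D [AD eA eD]] := rho_class_energy _ lA; first lra.
have ln0 : l != 0 by rewrite gt_eqF.
exists (l%:C \*: D); split=> [x y|v s|v s].
- rewrite [X in rdot x X]/= rdotZr -AD /= rdotZl mulrA divff ?mul1r //.
- exact: (energy_unscale rho12 l0 lm (eA v s)).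
- apply: (energy_unscale rho12 l0 lm).
  have -> : (fun x => l^-1%:C *: (l%:C \*: D) x) = D.
    apply: funext => x /=.
    by rewrite scalerA -rmorphM mulVf // rmorph1 scale1r.
  exact: eD.
Qed.

Lemma energy_mean (R : realType) (H : hilbertType R) (A C : H -> H)
    (e d k : R) v s : 0 <= k ->
  0 <= energy A e d k v s -> 0 <= energy C e d k v s ->
  0 <= energy (fun x => 2^-1%:C *: (A x + C x)) e d k v s.
Proof.
move=> k0 eA eC.
suff h : energy A e d k v s + energy C e d k v s <=
  2 * energy (fun x => 2^-1%:C *: (A x + C x)) e d k v s by lra.
have kB x : 0 <= k * nsq (A x - C x) by rewrite mulr_ge0 ?nsq_ge0.
elim: s v {eA eC} => [|w s IHs] v /=; have := kB v; rewrite nsqB.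
  by rewrite nsqZ nsqD; lra.
by have := IHs w; rewrite nsqZ nsqD rdotZl rdotDl; lra.
Qed.

(** Polarization: [nsq (A x + C x) - nsq (A x - C x) = 4 * rdot (A x) (C x)]. *)
Lemma nsq_le_mean (R : realType) (H : hilbertType R) (A C : H -> H) x :
  rdot (A x) (C x) = nsq x -> nsq x <= nsq (2^-1%:C *: (A x + C x)).
Proof.
move=> AC; have := nsq_ge0 (A x - C x).
by rewrite nsqB nsqZ nsqD AC; lra.
Qed.

(** * Algebra of [Xrho] *)

(* With this [g], the values of [Xrho] and of the extremal weight are tied by
   X r = g + k, since both discriminants agree. *)
Lemma extremal_weight_root (R : realType) (rho r : R)
    (e := rho * r ^+ 2) (k := 2 - rho) (d := (rho - 1) * r)
    (g := Xrho rho r * r - k) :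
  1 <= rho <= 2 -> 1 < r ->
  d < g /\ g ^+ 2 - (e - k) * g + d ^+ 2 = 0.
Proof.
move=> /andP[rho1 rho2] r1.
have r0 : r != 0 by rewrite gt_eqF //; lra.
have dd0 : 0 < e - k - 2 * d.
  have -> : e - k - 2 * d = (r - 1) * (rho * r + 2 - rho).
    by rewrite /e /k /d; ring.
  by apply: mulr_gt0; nra.
have d0 : 0 <= d by rewrite /d; apply: mulr_ge0; lra.
have DE : (2 + rho * r ^+ 2 - rho) ^+ 2 - 4 * r ^+ 2 =
  (e - k) ^+ 2 - 4 * d ^+ 2.
  by rewrite /e /k /d; ring.
have gE : 2 * g = e - k + Num.sqrt ((e - k) ^+ 2 - 4 * d ^+ 2).
  by rewrite /g /Xrho DE /e /k; field.
have D0 : 0 <= (e - k) ^+ 2 - 4 * d ^+ 2 by nra.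
have := sqr_sqrtr D0; have := sqrtr_ge0 ((e - k) ^+ 2 - 4 * d ^+ 2).
have -> : Num.sqrt ((e - k) ^+ 2 - 4 * d ^+ 2) = 2 * g - (e - k) by lra.
by move=> g1 g2; split; lra.
Qed.

Lemma extremal_ratio (R : realType) (rho r n m : R)
    (e := rho * r ^+ 2) (k := 2 - rho) (d := (rho - 1) * r)
    (g := Xrho rho r * r - k) :
  1 <= rho <= 2 -> 1 < r ->
  (k * g + d ^+ 2) * m <= g * (g + k) * n -> m <= Xrho rho r ^+ 2 * n.
Proof.
move=> rho12 r1 h; have [dg gE] := extremal_weight_root rho12 r1.
case/andP: rho12 => rho1 rho2.
have d0 : 0 <= d by rewrite /d; apply: mulr_ge0; lra.
have g0 : 0 < g by apply: le_lt_trans dg.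
have k0 : 0 <= k by rewrite /k; lra.
have r0 : 0 < r by lra.
(* This is [k] times the quadratic for [g], with [r^2 = d^2 + k e]; it turns the ratio
   [g (g + k) / (k g + d^2)] into [((g + k) / r)^2]. *)
have key : (g + k) * (k * g + d ^+ 2) = r ^+ 2 * g.
  rewrite -/d -/e -/k -/g in gE *.
  have -> : r ^+ 2 = d ^+ 2 + k * e by rewrite /d /k /e; ring.
  have : k * (g ^+ 2 - (e - k) * g + d ^+ 2) = 0 by rewrite gE mulr0.
  by move=> h1; lra.
have XE : Xrho rho r * r = g + k by rewrite /g; ring.
have := ler_wpM2l (addr_ge0 (ltW g0) k0) h.
rewrite mulrA key => h1.
rewrite -(ler_pM2l (mulr_gt0 (exprn_gt0 2 r0) g0)); apply: le_trans h1 _.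
by rewrite -XE le_eqVlt; apply/orP; left; apply/eqP; ring.
Qed.

(** [Xrho rho r] is the larger root of [r x^2 - q x + r], whose roots have product 1; so on [x >= 1]
    the sign of the quadratic decides. *)
Lemma le_Xrho (R : realType) (rho r x : R) :
  1 <= rho <= 2 -> 1 <= r -> 1 <= x ->
  (x <= Xrho rho r) = (r * (x ^+ 2 + 1) <= (2 + rho * r ^+ 2 - rho) * x).
Proof.
move=> /andP[rho1 rho2] r1 x1; set q := 2 + rho * r ^+ 2 - rho.
have q2r : 0 <= q - 2 * r.
  have -> : q - 2 * r = (r - 1) * (rho * r + rho - 2) by rewrite /q; ring.
  by apply: mulr_ge0; nra.
have D0 : 0 <= q ^+ 2 - 4 * r ^+ 2.
  by have -> : q ^+ 2 - 4 * r ^+ 2 = (q - 2 * r) * (q + 2 * r); [ring | nra].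
rewrite /Xrho -/q ler_pdivlMr; last by lra.
have := sqr_sqrtr D0; have := sqrtr_ge0 (q ^+ 2 - 4 * r ^+ 2).
set delta := Num.sqrt _ => delta0 deltaE.
apply/idP/idP => h; last first.
  have h2 : (2 * r * x - q) ^+ 2 <= delta ^+ 2.
    have := mulr_ge0 (ler0n R 4) (mulr_ge0 (le_trans ler01 r1) _).
    by move=> /(_ (q * x - r * (x ^+ 2 + 1))); rewrite subr_ge0 h deltaE; lra.
  have [h1|h1] := leP q (2 * r * x); last by lra.
  by move: h2; rewrite ler_sqr ?nnegrE; lra.
have [h1|h1] := leP q (2 * r * x).
  have : (2 * r * x - q) ^+ 2 <= delta ^+ 2.
    by rewrite ler_sqr ?nnegrE //; lra.
  by rewrite deltaE; nra.
have : 0 <= (x - 1) * (q - r * (x + 1)) by apply: mulr_ge0; nra.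
by nra.
Qed.

Lemma Xrho_ge1 (R : realType) (rho r : R) :
  1 <= rho <= 2 -> 1 <= r -> 1 <= Xrho rho r.
Proof.
move=> rho12 r1; rewrite le_Xrho //; case/andP: rho12 => rho1 rho2.
suff : 0 <= (r - 1) * (rho * r + rho - 2) by lra.
by apply: mulr_ge0; nra.
Qed.

Lemma le_Xrho_limit (R : realType) (rho r x : R) :
  1 <= rho <= 2 -> 1 <= r -> 1 <= x ->
  (forall m, r < m -> x <= Xrho rho m) -> x <= Xrho rho r.
Proof.
move=> rho12 r1 x1 h; rewrite le_Xrho //; apply/ler_addgt0Pr => eps eps0.
have c0 : 0 < rho * (2 * r + 1) * x.
  by case/andP: rho12 => rho1 _; rewrite !mulr_gt0 //; lra.
set c := rho * (2 * r + 1) * x in c0.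
(* For [z <= 1], passing from [r] to [r + z] raises the right-hand side by at most [z * c]. *)
pose z := Num.min 1 (eps / c).
have z0 : 0 < z by rewrite lt_min ltr01 divr_gt0.
have z1 : z <= 1 by rewrite ge_min lexx.
have zc : z * c <= eps by rewrite -ler_pdivlMr // ge_min lexx orbT.
have := h (r + z); rewrite ltrDl => /(_ z0).
rewrite le_Xrho //; last by lra.
have : z * (rho * (2 * r + z) * x) <= z * c.
  rewrite ler_pM2l // /c ler_pM2r; last by lra.
  by rewrite ler_wpM2l //; case/andP: rho12 => rho1 _; lra.
have : 0 <= z * (x ^+ 2 + 1) by rewrite mulr_ge0 ?addr_ge0 ?sqr_ge0 // ltW.
by lra.
Qed.

(** * From the mean operator to the norm of [A] *)

(** Multiplied by [a], the last hypothesis has left side at least [(a + n)^2], because [n^2 <= a b];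
    and [a + n = (s^2 + 1) n] for [s = sqrt (a / n)]. *)
Lemma mean_quadratic (R : realType) (a b n X : R) :
  0 <= X -> 0 < n -> n ^+ 2 <= a * b -> 0 <= a -> 0 <= b ->
  a + 2 * n + b <= 4 * X ^+ 2 * n ->
  Num.sqrt (a / n) ^+ 2 + 1 <= 2 * X * Num.sqrt (a / n).
Proof.
set s := Num.sqrt _ => X0 n0 nab a0 b0 h.
have s0 : 0 <= s by exact: sqrtr_ge0.
have aE : a = s ^+ 2 * n.
  by rewrite sqr_sqrtr ?divr_ge0 ?(ltW n0) // divfK ?gt_eqF.
rewrite -ler_sqr ?nnegrE; last 2 first.
- by apply: addr_ge0; rewrite ?sqr_ge0 ?ler01.
- by rewrite !mulr_ge0.
have h1 := ler_wpM2l a0 h.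
rewrite -(ler_pM2r (exprn_gt0 2 n0)).
have -> : (2 * X * s) ^+ 2 * n ^+ 2 = a * (4 * X ^+ 2 * n) by rewrite aE; ring.
apply: le_trans h1; rewrite !mulrDr.
have -> : (s ^+ 2 + 1) ^+ 2 * n ^+ 2 = a * a + a * (2 * n) + n ^+ 2.
  by rewrite aE; ring.
by rewrite lerD2l.
Qed.

Lemma nsq_image_quadratic (R : realType) (rho r m : R) (H : hilbertType R)
    (A B : {linear H -> H}) x (s := Num.sqrt (nsq (A x) / nsq x)) :
  1 <= rho <= 2 -> 1 <= r -> r < m -> cancel A B -> cancel B A ->
  (rho_radius rho A <= r%:E)%E -> (rho_radius rho B <= r%:E)%E ->
  0 < nsq x -> s ^+ 2 + 1 <= 2 * Xrho rho m * s.
Proof.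
move=> rho12 r1 rm AB BA rA rB x0; have /andP[rho1 rho2] := rho12.
have m1 : 1 < m by apply: le_lt_trans rm.
have [D [AD eA _]] := rho_radius_energy rho12 rA rm.
(* The adjoint [C] of [B] inherits the energy bound, so it can be averaged with [A]. *)
have [C [BC _ eC]] := rho_radius_energy rho12 rB rm.
pose M y := 2^-1%:C *: (A y + C y).
pose M' y := 2^-1%:C *: (D y + B y).
have AC y z : rdot (A y) (C z) = rdot y z by rewrite -BC AB.
have MM' y z : rdot (M y) z = rdot y (M' z).
  by rewrite rdotZl rdotDl AD (rdotC (C y)) -BC (rdotC (B z)) rdotZr rdotDr.
have nM y : nsq y <= nsq (M y) by apply: nsq_le_mean; rewrite AC.
have nM' y : nsq y <= nsq (M' y).
  by apply: nsq_le_mean; rewrite rdotC -AD BA.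
have k0 : 0 <= 2 - rho by lra.
have d0 : 0 <= (rho - 1) * m by apply: mulr_ge0; lra.
have eM v s' : 0 <= energy M (rho * m ^+ 2) ((rho - 1) * m) (2 - rho) v s'.
  exact: energy_mean.
have [dg gE] := extremal_weight_root rho12 m1.
have := nsq_image_le MM' nM nM' d0 k0 dg gE eM x.
move=> /(extremal_ratio rho12 m1); rewrite nsqZ nsqD AC -/(nsq x) => h.
apply: (@mean_quadratic _ _ (nsq (C x)) _ _ _ x0) => //; last 1 first.
- by lra.
- by apply: (le_trans ler01); exact: Xrho_ge1 (ltW m1).
- by rewrite -[nsq x in X in X <= _](AC x x) sqr_rdot_le.
- exact: nsq_ge0.
- exact: nsq_ge0.
Qed.

Lemma opnorm_bound (R : realType) (rho r : R) (H : hilbertType R)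
    (A B : {linear H -> H}) :
  1 <= rho <= 2 -> 1 <= r -> cancel A B -> cancel B A ->
  (rho_radius rho A <= r%:E)%E -> (rho_radius rho B <= r%:E)%E ->
  (opnorm A <= (Xrho rho r + Num.sqrt (Xrho rho r ^+ 2 - 1))%:E)%E.
Proof.
move=> rho12 r1 AB BA rA rB.
apply: ge_ereal_sup => _ [x /= x1 <-]; rewrite lee_fin.
have X1 := Xrho_ge1 rho12 r1; set X := Xrho rho r in X1 *.
have rhs0 : 0 <= X + Num.sqrt (X ^+ 2 - 1).
  by rewrite addr_ge0 ?sqrtr_ge0 //; lra.
have re_ge0 (y : H) : 0 <= complex.Re `|y|.
  by have := normr_ge0 y; rewrite lecE => /andP[].
have x1' : complex.Re `|x| <= 1 by move: x1; rewrite lecE => /andP[].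
have [x0|xn0] := eqVneq (nsq x) 0.
  by rewrite (nsq_eq0 x0) linear0 normr0.
have xp : 0 < nsq x by rewrite lt_def xn0 nsq_ge0.
have Ap : 0 < nsq (A x).
  rewrite lt_def nsq_ge0 andbT; apply: contraNneq xn0 => /nsq_eq0 Ax0.
  by rewrite -(AB x) Ax0 linear0 nsq_normE normr0 /= expr0n.
have := nsq_image_quadratic rho12 r1 _ AB BA rA rB xp.
set s := Num.sqrt _ => sle.
have s0 : 0 < s by rewrite sqrtr_gt0 divr_gt0.
(* Written as [mu <= Xrho rho m], the quadratic bound lets [m] decrease to [r]. *)
pose mu := (s ^+ 2 + 1) / (2 * s).
have muE : s ^+ 2 + 1 = 2 * mu * s by rewrite /mu; field; rewrite gt_eqF.
have mu1 : 1 <= mu by have := sqr_ge0 (s - 1); nra.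
have muX : mu <= X.
  apply: le_Xrho_limit => // m rm.
  by have := sle m rm; rewrite muE ler_pM2r // ler_pM2l.
have sX : s - X <= Num.sqrt (X ^+ 2 - 1).
  have [sX|Xs] := leP s X.
    by rewrite (le_trans _ (sqrtr_ge0 _)) // subr_le0.
  rewrite -[s - X]ger0_norm ?subr_ge0 ?(ltW Xs) // -sqrtr_sqr ler_wsqrtr //.
  by have := ler_wpM2r (ltW s0) muX; nra.
have : complex.Re `|A x| <= s.
  rewrite -ler_sqr ?nnegrE ?re_ge0 ?(ltW s0) // -nsq_normE.
  rewrite sqr_sqrtr ?divr_ge0 ?nsq_ge0 // ler_pdivlMr // ler_piMr ?nsq_ge0 //.
  by rewrite nsq_normE expr_le1.
by lra.
Qed.

Theorem theorem1p4 (R : realType) (rho r : R) (hrho : 1 <= rho <= 2)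
    (hr : 1 <= r) :
  (psi rho r <= (Xrho rho r + Num.sqrt (Xrho rho r ^+ 2 - 1))%:E)%E.
Proof.
apply: ge_ereal_sup => _ [H [A [B [_ [_ AB BA] rA rB ->]]]].
exact: (opnorm_bound hrho hr AB BA rA rB).
Qed.
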